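(* Let $(\mathcal{N},\circ_\lambda,\ast_\lambda)$ be a Novikov-Poisson conformal algebra. Define $$[a_\lambda b]=a\ast_\lambda b-b\ast_{-\partial-\lambda}a,\qquad a,b\in\mathcal{N}.$$ Then $(\mathcal{N},\circ_\lambda,[\cdot_\lambda\cdot])$ is a transposed Poisson conformal algebra.
   Context: All vector spaces, linear maps and tensor products are over $\mathbb{C}$. For a vector space $A$, $A[\lambda]$ denotes polynomials in $\lambda$ with coefficients in $A$. A conformal algebra $(A,\circ_\lambda)$ is a $\mathbb{C}[\partial]$-module $A$ with a $\mathbb{C}$-bilinear map $A\otimes A\to A[\lambda]$, $a\otimes b\mapsto a\circ_\lambda b$, such that $(\partial a)\circ_\lambda b=-\lambda\, a\circ_\lambda b$ and $a\circ_\lambda(\partial b)=(\partial+\lambda)(a\circ_\lambda b)$. Convention: products are extended linearly to polynomials in formal variables. If $a\circ_\lambda b=\sum_n\lambda^n w_n$ and $\nu$ is a linear combination of formal variables, then $a\circ_{-\partial+\nu}b=\sum_n(-\partial+\nu)^n w_n$, where $\partial$ acts on the coefficients $w_n$ of the product carrying that subscript; the same convention applies to $\ast_\lambda$ and $[\cdot_\lambda\cdot]$. A commutative associative conformal algebra is a conformal algebra with $a\circ_\lambda(b\circ_\mu c)=(a\circ_\lambda b)\circ_{\lambda+\mu}c$ and $a\circ_\lambda b=b\circ_{-\partial-\lambda}a$ for all $a,b,c$. A Lie conformal algebra $(A,[\cdot_\lambda\cdot])$ is a conformal algebra (with product written $[a_\lambda b]$) such that $[a_\lambda b]=-[b_{-\lambda-\partial}a]$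 and $[a_\lambda[b_\mu c]]=[[a_\lambda b]_{\lambda+\mu}c]+[b_\mu[a_\lambda c]]$ for all $a,b,c$. A left-symmetric conformal algebra $(A,\ast_\lambda)$ is a conformal algebra with $(a\ast_\lambda b)\ast_{\lambda+\mu}c-a\ast_\lambda(b\ast_\mu c)=(b\ast_\mu a)\ast_{\lambda+\mu}c-b\ast_\mu(a\ast_\lambda c)$ for all $a,b,c$. A Novikov conformal algebra is a left-symmetric conformal algebra with $(a\ast_\lambda b)\ast_{\lambda+\mu}c=(a\ast_\lambda c)\ast_{-\mu-\partial}b$ for all $a,b,c$. A Novikov-Poisson conformal algebra $(\mathcal{N},\circ_\lambda,\ast_\lambda)$ is a $\mathbb{C}[\partial]$-module $\mathcal{N}$ such that $(\mathcal{N},\circ_\lambda)$ is a commutative associative conformal algebra, $(\mathcal{N},\ast_\lambda)$ is a Novikov conformal algebra, and for all $a,b,c\in\mathcal{N}$: $(a\circ_\lambda b)\ast_{\lambda+\mu}c=a\circ_\lambda(b\ast_\mu c)$ and $(a\ast_\lambda b)\circ_{\lambda+\mu}c-a\ast_\lambda(b\circ_\mu c)=(b\ast_\mu a)\circ_{\lambda+\mu}c-b\ast_\mu(a\circ_\lambda c)$. A transposed Poisson conformal algebra (TPCA) is a $\mathbb{C}[\partial]$-module $\mathcal{L}$ with $\mathbb{C}$-bilinear maps $\circ_\lambda,[\cdot_\lambda\cdot]:\mathcal{L}\otimes\mathcal{L}\to\mathcal{L}[\lambda]$ such that $(\mathcal{L},\circ_\lambda)$ is a commutative associative conformal algebra,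 $(\mathcal{L},[\cdot_\lambda\cdot])$ is a Lie conformal algebra, and $2(a\circ_\lambda[b_\mu c])=[(a\circ_\lambda b)_{\lambda+\mu}c]+[b_\mu(a\circ_\lambda c)]$ for all $a,b,c\in\mathcal{L}$. *)

(* Defs.v *)
From HB Require Import structures.
From mathcomp Require Import all_boot all_order all_algebra.
From mathcomp Require Import reals complex finmap monalg.

Set Implicit Arguments.
Unset Strict Implicit.
Unset Printing Implicit Defensive.

Import GRing.Theory.
Local Open Scope ring_scope.

(* A C[d]-module is a module over the polynomial ring {poly R[i]}: the
   derivation d acts as 'X and a complex scalar c acts as c%:P.  The polynomials
   with coefficients in V in n commuting formal variables are the finitely
   supported families {malg V['X_{1..n}]} of coefficients in V, indexed by
   monomials: V[lambda] is n = 1 and V[lambda, mu] is n = 2. *)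
Section Polynomials.
Variables (R : realType) (V : lmodType {poly R[i]}) (n : nat).
Implicit Types (p : {malg V['X_{1..n}]}) (m : 'X_{1..n}).

Definition pscale (r : {poly R[i]}) p : {malg V['X_{1..n}]} :=
  \sum_(m <- msupp p) << r *: p@_m *g m >>.

Definition mulmon m0 p : {malg V['X_{1..n}]} :=
  \sum_(m <- msupp p) << p@_m *g mmul m0 m >>.

Definition mulvar (i : 'I_n) p : {malg V['X_{1..n}]} := mulmon (ucm i) p.

End Polynomials.

(* Multiplication operators on polynomials: d acts on the coefficients, lam and
   mu multiply by the variables lambda and mu.  A subscript such as -d - lambda
   is the operator \- (der \+ lam). *)
Definition der (R : realType) (V : lmodType {poly R[i]}) (n : nat) :
    {malg V['X_{1..n}]} -> {malg V['X_{1..n}]} :=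
  pscale 'X.

Definition lam (R : realType) (V : lmodType {poly R[i]}) (n : nat) :
    {malg V['X_{1..n.+1}]} -> {malg V['X_{1..n.+1}]} :=
  mulvar ord0.

Definition mu (R : realType) (V : lmodType {poly R[i]}) :
    {malg V['X_{1..2}]} -> {malg V['X_{1..2}]} :=
  mulvar ord_max.

Arguments der {R V n}.
Arguments lam {R V n}.
Arguments mu {R V}.

Section Products.
Variables (R : realType) (V : lmodType {poly R[i]}) (n : nat).
Implicit Types nu : {malg V['X_{1..n}]} -> {malg V['X_{1..n}]}.

(* If w = \sum_k lambda^k w_k then subst nu w = \sum_k nu^k w_k. *)
Definition subst nu (w : {malg V['X_{1..1}]}) : {malg V['X_{1..n}]} :=
  \sum_(k <- msupp w) iter (mdeg k) nu (w@_k)%:MP.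

(* The product x o_nu y, extended linearly to polynomials x and y.  The powers
   of nu are applied to the products of coefficients, so a d occurring in nu acts
   on the coefficients of this very product only. *)
Definition pprod (f : V -> V -> {malg V['X_{1..1}]}) nu
    (x y : {malg V['X_{1..n}]}) : {malg V['X_{1..n}]} :=
  \sum_(k <- msupp x) \sum_(l <- msupp y)
    mulmon (mmul k l) (subst nu (f x@_k y@_l)).

End Products.

Section Algebras.
Variables (R : realType) (V : lmodType {poly R[i]}).
Implicit Types (f circ star br : V -> V -> {malg V['X_{1..1}]}) (a b c : V).

Record conformal_algebra f : Prop := ConformalAlgebra {
  conf_linl : forall (z : R[i]) a a' b,
    f (z%:P *: a + a') b = pscale z%:P (f a b) + f a' b;
  conf_linr : forall (z : R[i]) a b b',
    f a (z%:P *: b + b') = pscale z%:P (f a b) + f a b';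
  conf_derl : forall a b, f ('X *: a) b = - lam (f a b);
  conf_derr : forall a b, f a ('X *: b) = (der \+ lam) (f a b)
}.

Record comm_assoc_conformal_algebra circ : Prop := CommAssocConformalAlgebra {
  cac_conf : conformal_algebra circ;
  cac_assoc : forall a b c,
    pprod circ lam a%:MP (pprod circ mu b%:MP c%:MP) =
    pprod circ (lam \+ mu) (pprod circ lam a%:MP b%:MP) c%:MP;
  cac_comm : forall a b, circ a b = subst (\- (der \+ lam)) (circ b a)
}.

Record lie_conformal_algebra br : Prop := LieConformalAlgebra {
  lie_conf : conformal_algebra br;
  lie_skew : forall a b, br a b = - subst (\- (lam \+ der)) (br b a);
  lie_jacobi : forall a b c,
    pprod br lam a%:MP (pprod br mu b%:MP c%:MP) =
    pprod br (lam \+ mu) (pprod br lam a%:MP b%:MP) c%:MP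
    + pprod br mu b%:MP (pprod br lam a%:MP c%:MP)
}.

Record left_symmetric_conformal_algebra star : Prop :=
    LeftSymmetricConformalAlgebra {
  lsym_conf : conformal_algebra star;
  lsym_eq : forall a b c,
    pprod star (lam \+ mu) (pprod star lam a%:MP b%:MP) c%:MP
    - pprod star lam a%:MP (pprod star mu b%:MP c%:MP) =
    pprod star (lam \+ mu) (pprod star mu b%:MP a%:MP) c%:MP
    - pprod star mu b%:MP (pprod star lam a%:MP c%:MP)
}.

Record novikov_conformal_algebra star : Prop := NovikovConformalAlgebra {
  nov_lsym : left_symmetric_conformal_algebra star;
  nov_eq : forall a b c,
    pprod star (lam \+ mu) (pprod star lam a%:MP b%:MP) c%:MP =
    pprod star (\- (mu \+ der)) (pprod star lam a%:MP c%:MP) b%:MP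
}.

Record novikov_poisson_conformal_algebra circ star : Prop :=
    NovikovPoissonConformalAlgebra {
  np_circ : comm_assoc_conformal_algebra circ;
  np_star : novikov_conformal_algebra star;
  np_compat1 : forall a b c,
    pprod star (lam \+ mu) (pprod circ lam a%:MP b%:MP) c%:MP =
    pprod circ lam a%:MP (pprod star mu b%:MP c%:MP);
  np_compat2 : forall a b c,
    pprod circ (lam \+ mu) (pprod star lam a%:MP b%:MP) c%:MP
    - pprod star lam a%:MP (pprod circ mu b%:MP c%:MP) =
    pprod circ (lam \+ mu) (pprod star mu b%:MP a%:MP) c%:MP
    - pprod star mu b%:MP (pprod circ lam a%:MP c%:MP)
}.

Record transposed_poisson_conformal_algebra circ br : Prop :=
    TransposedPoissonConformalAlgebra {
  tp_circ : comm_assoc_conformal_algebra circ;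
  tp_lie : lie_conformal_algebra br;
  tp_compat : forall a b c,
    pprod circ lam a%:MP (pprod br mu b%:MP c%:MP) *+ 2 =
    pprod br (lam \+ mu) (pprod circ lam a%:MP b%:MP) c%:MP
    + pprod br mu b%:MP (pprod circ lam a%:MP c%:MP)
}.

End Algebras.

(* Main.v *)
Require Import Defs.
From mathcomp Require Import all_boot all_order all_algebra.
From mathcomp Require Import reals complex finmap monalg.

Set Implicit Arguments.
Unset Strict Implicit.
Unset Printing Implicit Defensive.

Import GRing.Theory.
Local Open Scope ring_scope.

(** The commutator of an ordinary Novikov-Poisson algebra is transposed
    Poisson by two short computations. Jacobi's identity is a signed sum of
    the left symmetry identities for the three cyclic rearrangements of its
    arguments. For the compatibility, [ab,c] + [b,ac] equals a[b,c] + b*(ac)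
    - c*(ab) because (ab)*c = a(b*c) and (ac)*b = a(c*b), and b*(ac) - c*(ab)
    = a[b,c] is the second Novikov-Poisson axiom for the arguments b, c, a.

    The conformal statement is the same computation, once the axioms may be
    used for permuted arguments. In an identity in N[lambda, mu] the argument
    a carries the weight lambda, b the weight mu, and c the implicit third
    weight - d - lambda - mu. Hence the axiom for b, c, a, with weights
    lambda, mu for b, c, becomes an identity for the weights required by the
    conclusion after the substitution of mu for lambda and of - d - lambda -
    mu for mu. This substitution is an additive operator on N[lambda, mu]
    (subst2), and the point is that it sends each nested product to a nested
    product with other subscripts (transport_left, transport_right and the
    four rotation lemmas).

    A nested product is a sum over the powers of the inner subscript, so to
    compare two of them it suffices to know how the outer operation carries
    the inner subscript to an operator on the result (intertwines,
    subst_transport): by sesquilinearity, d acting on the left factor of a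
    product with subscript nu becomes - nu, and d acting on the right factor
    becomes d + nu. Finally the product with exchanged arguments is the
    product with subscript nu replaced by - d - nu (pprod_opposite), which
    expands every bracket into products; what remains is a cancellation in an
    abelian group. *)

(** * Additive maps on finitely supported families *)

Section AdditiveMaps.
Variables U W : zmodType.
Implicit Type F : U -> W.

Lemma morphD0 F : {morph F : x y / x + y} -> F 0 = 0.
Proof. by move=> FD; apply: (addrI (F 0)); rewrite -FD !addr0. Qed.

Lemma morphDN F : {morph F : x y / x + y} -> {morph F : x / - x}.
Proof.
move=> FD x; apply/eqP; rewrite -subr_eq0 opprK -FD addNr.
exact/eqP/morphD0.
Qed.

Lemma morphDB F : {morph F : x y / x + y} -> {morph F : x y / x - y}.
Proof. by move=> FD x y; rewrite FD morphDN. Qed.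

End AdditiveMaps.

Lemma comp_morphD (U V W : zmodType) (F : V -> W) (G : U -> V) :
  {morph F : x y / x + y} -> {morph G : x y / x + y} ->
  {morph (fun x => F (G x)) : x y / x + y}.
Proof. by move=> FD GD x y; rewrite GD FD. Qed.

Lemma iter_morphD (U : zmodType) (F : U -> U) k :
  {morph F : x y / x + y} -> {morph iter k F : x y / x + y}.
Proof. by move=> FD; elim: k => [|k IH] x y //=; rewrite IH FD. Qed.

Lemma sum_morphD (I : Type) (U W : zmodType) (s : seq I) (F : I -> U -> W) :
  (forall i, {morph F i : x y / x + y}) ->
  {morph (fun x => \sum_(i <- s) F i x) : x y / x + y}.
Proof.
by move=> FD x y; rewrite -big_split; apply: eq_bigr => i _; apply: FD.
Qed.

Section FiniteSupport.
Variables (K : monomType) (V W : zmodType).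
Implicit Types (F : K -> V -> W) (p : {malg V[K]}).

Lemma morphD_ext (F G : {malg V[K]} -> W) :
  {morph F : p q / p + q} -> {morph G : p q / p + q} ->
  (forall c k, F << c *g k >> = G << c *g k >>) -> F =1 G.
Proof.
move=> FD GD FG p; rewrite [p]monalgE.
elim/big_ind: _ => [|x y Fx Fy|k _]; last exact: FG.
  by rewrite !morphD0.
by rewrite FD GD Fx Fy.
Qed.

Lemma morphD_ext2 (F G : {malg V[K]} -> {malg V[K]} -> W) :
  (forall q, {morph F^~ q : p p' / p + p'}) ->
  (forall p, {morph F p : q q' / q + q'}) ->
  (forall q, {morph G^~ q : p p' / p + p'}) ->
  (forall p, {morph G p : q q' / q + q'}) ->
  (forall a k b l, F << a *g k >> << b *g l >> = G << a *g k >> << b *g l >>) ->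
  forall p q, F p q = G p q.
Proof.
move=> FDl FDr GDl GDr FG p q; move: p.
apply: (morphD_ext (FDl q) (GDl q)) => a k; move: q.
by apply: morphD_ext.
Qed.

Lemma sum_msuppU F c k : F k 0 = 0 ->
  \sum_(l <- msupp << c *g k >>) F l << c *g k >>@_l = F k c.
Proof.
rewrite msuppU => F0; case: (eqVneq c 0) => [->|_].
  by rewrite big_seq_fset0 F0.
by rewrite big_seq_fset1 mcoeffUU.
Qed.

Lemma sum_msuppEw F p (D : {fset K}) : (forall k, F k 0 = 0) ->
  (msupp p `<=` D)%fset ->
  \sum_(k <- msupp p) F k p@_k = \sum_(k <- D) F k p@_k.
Proof.
by move=> F0 pD; apply: big_fset_incl => // k _ /mcoeff_outdom ->.
Qed.

Lemma sum_msuppD F : (forall k, {morph F k : x y / x + y}) ->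
  {morph (fun p => \sum_(k <- msupp p) F k p@_k) : p q / p + q}.
Proof.
move=> FD p q; have F0 k : F k 0 = 0 by apply: morphD0.
have pU : (msupp p `<=` msupp p `|` msupp q)%fset by apply: fsubsetUl.
have qU : (msupp q `<=` msupp p `|` msupp q)%fset by apply: fsubsetUr.
rewrite (sum_msuppEw F0 pU) (sum_msuppEw F0 qU).
rewrite (sum_msuppEw F0 (msuppD_le p q)) -big_split /=.
by apply: eq_bigr => k _; rewrite mcoeffD FD.
Qed.

End FiniteSupport.

(** * Maps that send monomials to monomials *)

Section MonomialMaps.
Variables (K : monomType) (V : zmodType).
Implicit Types A B : {malg V[K]} -> {malg V[K]}.

(** Scalars and monomials both act in this way; such operators are determined
    by the pair (f, s), so that commutation can be checked on coefficients
    and on exponents separately. *)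
Record monomial_map A (f : V -> V) (s : K -> K) : Prop := MonomialMap {
  monomial_mapD : {morph A : p q / p + q};
  monomial_mapU : forall c k, A << c *g k >> = << f c *g s k >>
}.

Lemma monomial_map_comp A B f g s t :
  monomial_map A f s -> monomial_map B g t ->
  monomial_map (fun p => A (B p)) (fun c => f (g c)) (fun k => s (t k)).
Proof.
move=> [AD AU] [BD BU]; split; first exact: comp_morphD.
by move=> c k; rewrite BU AU.
Qed.

Lemma iter_monomial_map A s k :
  monomial_map A id s -> monomial_map (iter k A) id (iter k s).
Proof.
move=> AM; elim: k => [|k IH]; first by split.
exact: monomial_map_comp AM IH.
Qed.

Lemma eq_monomial_map A B f g s t :
  monomial_map A f s -> monomial_map B g t -> f =1 g -> s =1 t -> A =1 B.
Proof.
move=> [AD AU] [BD BU] fg st; apply: morphD_ext => // c k.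
by rewrite AU BU fg st.
Qed.

End MonomialMaps.

(** * Operators on polynomials with coefficients in a module *)

Section PolynomialOperators.
Variables (R : realType) (V : lmodType {poly R[i]}).
Local Notation pol n := {malg V['X_{1..n}]}.

Section AnyArity.
Variable n : nat.
Implicit Types (p q : pol n) (m : 'X_{1..n}).

Lemma pscaleU r c m : pscale r << c *g m >> = << r *: c *g m >> :> pol n.
Proof.
by rewrite /pscale (sum_msuppU (F := fun k a => << r *: a *g k >>)) //
  scaler0 monalgU0.
Qed.

Lemma pscaleD r : {morph @pscale R V n r : p q / p + q}.
Proof.
apply: (sum_msuppD (F := fun k a => << r *: a *g k >>)) => k x y.
by rewrite scalerDr monalgUD.
Qed.

Lemma mulmonU m0 c m : mulmon m0 << c *g m >> = << c *g mmul m0 m >> :> pol n.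
Proof.
by rewrite /mulmon (sum_msuppU (F := fun k a => << a *g mmul m0 k >>)) //
  monalgU0.
Qed.

Lemma mulmonD m : {morph @mulmon R V n m : p q / p + q}.
Proof.
apply: (sum_msuppD (F := fun k a => << a *g mmul m k >>)) => k x y.
by rewrite monalgUD.
Qed.

Lemma pscale_monomial r : monomial_map (@pscale R V n r) ( *:%R r) id.
Proof. split; [exact: pscaleD | exact: pscaleU]. Qed.

Lemma mulmon_monomial m : monomial_map (@mulmon R V n m) id (mmul m).
Proof. split; [exact: mulmonD | exact: mulmonU]. Qed.

Lemma pscale1 p : pscale 1 p = p.
Proof.
have idM : monomial_map (@id (pol n)) id id by [].
by apply: (eq_monomial_map (pscale_monomial 1) idM) => // c; apply: scale1r.
Qed.

Lemma mulmon1 p : mulmon mone p = p.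
Proof.
have idM : monomial_map (@id (pol n)) id id by [].
by apply: (eq_monomial_map (mulmon_monomial mone) idM) => // m; apply: mul1m.
Qed.

Lemma pscale_comm r t p : pscale r (pscale t p) = pscale t (pscale r p).
Proof.
have rM := pscale_monomial r; have tM := pscale_monomial t.
apply: (eq_monomial_map (monomial_map_comp rM tM) (monomial_map_comp tM rM)).
  by move=> c; rewrite !scalerA mulrC.
by [].
Qed.

Lemma mulmonA m1 m2 p : mulmon m1 (mulmon m2 p) = mulmon (mmul m1 m2) p.
Proof.
have M := mulmon_monomial.
apply: (eq_monomial_map (monomial_map_comp (M m1) (M m2)) (M _)) => // k.
exact: mulmA.
Qed.

Lemma mulmon_comm m1 m2 p : mulmon m1 (mulmon m2 p) = mulmon m2 (mulmon m1 p).
Proof.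
have M := mulmon_monomial; have M2 k l := monomial_map_comp (M k) (M l).
apply: (eq_monomial_map (M2 m1 m2) (M2 m2 m1)) => // k.
by rewrite !mulmA (mulmC m1).
Qed.

Lemma pscale_mulmon r m p : pscale r (mulmon m p) = mulmon m (pscale r p).
Proof.
have rM := pscale_monomial r; have mM := mulmon_monomial m.
exact: (eq_monomial_map (monomial_map_comp rM mM) (monomial_map_comp mM rM)).
Qed.

(** Linearity over C[d][lambda, ...]; every subscript that occurs in a
    product is an operator of this kind, and it is what lets a subscript be
    moved past the scalars and the variables of other factors. *)
Record polylinear (nu : pol n -> pol n) : Prop := PolyLinear {
  plinD : {morph nu : p q / p + q};
  plinZ : forall r, {morph nu : p / pscale r p};
  plinM : forall m, {morph nu : p / mulmon m p}
}.

Lemma pscale_polylinear r : polylinear (pscale r).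
Proof.
split=> [|t p|m p]; [exact: pscaleD | exact: pscale_comm |].
exact: pscale_mulmon.
Qed.

Lemma mulmon_polylinear m : polylinear (mulmon m).
Proof.
split=> [|t p|l p]; [exact: mulmonD | exact/esym/pscale_mulmon |].
exact: mulmon_comm.
Qed.

Lemma polylinearD nu1 nu2 :
  polylinear nu1 -> polylinear nu2 -> polylinear (nu1 \+ nu2).
Proof.
move=> [D1 Z1 M1] [D2 Z2 M2]; split=> [p q|r p|m p] /=.
- by rewrite D1 D2 addrACA.
- by rewrite Z1 Z2 pscaleD.
- by rewrite M1 M2 mulmonD.
Qed.

Lemma polylinearN nu : polylinear nu -> polylinear (\- nu).
Proof.
move=> [D Z M]; split=> [p q|r p|m p] /=.
- by rewrite D opprD.
- by rewrite Z (morphDN (@pscaleD r)).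
- by rewrite M (morphDN (@mulmonD m)).
Qed.

Lemma der_polylinear : polylinear der.
Proof. exact: pscale_polylinear. Qed.

End AnyArity.

Lemma lam_polylinear n : polylinear (@lam R V n).
Proof. exact: mulmon_polylinear. Qed.

Lemma mu_polylinear : polylinear (@mu R V).
Proof. exact: mulmon_polylinear. Qed.

End PolynomialOperators.

(** * Intertwining operators *)

Section Intertwining.
Variables U W : zmodType.
Implicit Types (phi : U -> W) (rho : U -> U) (theta : W -> W).

(** The way in which phi carries an operator on its source to one on its
    target. Subscripts are built from d and the variables by sums and
    opposites, so the three closure lemmas below reduce every such question
    to d, lambda and mu. *)
Definition intertwines phi rho theta := forall x, phi (rho x) = theta (phi x).

Lemma intertwinesN phi rho theta : {morph phi : x y / x + y} ->
  intertwines phi rho theta -> intertwines phi (\- rho) (\- theta).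
Proof. by move=> phiD H x /=; rewrite (morphDN phiD) H. Qed.

Lemma intertwinesD phi rho1 rho2 theta1 theta2 : {morph phi : x y / x + y} ->
  intertwines phi rho1 theta1 -> intertwines phi rho2 theta2 ->
  intertwines phi (rho1 \+ rho2) (theta1 \+ theta2).
Proof. by move=> phiD H1 H2 x /=; rewrite phiD H1 H2. Qed.

Lemma eq_intertwines phi rho theta theta' : theta =1 theta' ->
  intertwines phi rho theta -> intertwines phi rho theta'.
Proof. by move=> E H x; rewrite H E. Qed.

Lemma intertwines_iter phi rho theta k :
  intertwines phi rho theta -> intertwines phi (iter k rho) (iter k theta).
Proof. by move=> H; elim: k => [|k IH] x //=; rewrite H IH. Qed.

End Intertwining.

Lemma intertwines_comp (U1 U2 U3 : zmodType) (phi : U1 -> U2) (psi : U2 -> U3)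
    rho1 rho2 rho3 :
  intertwines phi rho1 rho2 -> intertwines psi rho2 rho3 ->
  intertwines (fun x => psi (phi x)) rho1 rho3.
Proof. by move=> H1 H2 x; rewrite H1 H2. Qed.

(** * Substitution of an operator for one variable *)

Section Substitution.
Variables (R : realType) (V : lmodType {poly R[i]}).
Local Notation pol n := {malg V['X_{1..n}]}.

Section OneVariable.
Variable n : nat.
Implicit Types (nu rho : pol n -> pol n) (w : pol 1).

Lemma iter_polylinear nu k : polylinear nu -> polylinear (iter k nu).
Proof.
move=> [D Z M]; split.
- exact: iter_morphD.
- by move=> r p; apply/esym/intertwines_iter => x; apply/esym/Z.
- by move=> m p; apply/esym/intertwines_iter => x; apply/esym/M.
Qed.

Lemma iter_constD nu k : polylinear nu ->
  {morph (fun c : V => iter k nu c%:MP) : c c' / c + c'}.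
Proof.
move=> nuP; apply: (@comp_morphD V (pol n) (pol n)).
  exact/plinD/iter_polylinear.
exact: monalgUD.
Qed.

Lemma substD nu : polylinear nu -> {morph subst nu : w w' / w + w'}.
Proof.
move=> nuP; apply: (sum_msuppD (F := fun k c => iter (mdeg k) nu c%:MP)) => k.
exact: iter_constD.
Qed.

Lemma substU nu c k : polylinear nu ->
  subst nu << c *g k >> = iter (mdeg k) nu c%:MP.
Proof.
move=> nuP.
apply: (sum_msuppU (F := fun k c => iter (mdeg k) nu c%:MP)).
exact: (morphD0 (iter_constD (mdeg k) nuP)).
Qed.

Lemma substC nu c : polylinear nu -> subst nu c%:MP = c%:MP.
Proof. by move=> nuP; rewrite substU // mdeg1. Qed.

Lemma subst_lam nu : polylinear nu -> intertwines (subst nu) lam nu.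
Proof.
move=> nuP; have nuD := plinD nuP.
apply: morphD_ext => [||c k].
- exact: comp_morphD (substD nuP) (plinD (lam_polylinear V 0)).
- exact: comp_morphD nuD (substD nuP).
apply: etrans (congr1 (subst nu) (mulmonU _ c k)) _.
apply: etrans (substU _ _ nuP) _.
apply: etrans _ (esym (congr1 nu (substU c k nuP))).
by rewrite mdegM mdegU.
Qed.

Lemma subst_pscale nu r : polylinear nu ->
  intertwines (subst nu) (pscale r) (pscale r).
Proof.
move=> nuP.
apply: morphD_ext => [||c k].
- exact: comp_morphD (substD nuP) (@pscaleD _ _ _ r).
- exact: comp_morphD (@pscaleD _ _ _ r) (substD nuP).
apply: etrans (congr1 (subst nu) (pscaleU r c k)) _.
apply: etrans (substU _ _ nuP) _.
apply: etrans _ (esym (congr1 (pscale r) (substU c k nuP))).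
apply: etrans (plinZ (iter_polylinear (mdeg k) nuP) r _).
exact: (congr1 _ (esym (pscaleU r c _))).
Qed.

End OneVariable.

(** Both sides are additive in w, and on the monomial lambda^k c they are
    theta^k applied to the common value of phi and psi on the constant c. *)
Lemma subst_transport (W : zmodType) n n' (nu : pol n -> pol n)
    (rho : pol n' -> pol n') (phi : pol n -> W) (psi : pol n' -> W)
    (theta : W -> W) :
  polylinear nu -> polylinear rho ->
  {morph phi : x y / x + y} -> {morph psi : x y / x + y} ->
  intertwines phi nu theta -> intertwines psi rho theta ->
  (forall v, phi v%:MP = psi v%:MP) ->
  forall w, phi (subst nu w) = psi (subst rho w).
Proof.
move=> nuP rhoP phiD psiD phiI psiI phi_psi.
apply: morphD_ext => [||c k].
- exact: comp_morphD phiD (substD nuP).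
- exact: comp_morphD psiD (substD rhoP).
apply: etrans (congr1 phi (substU c k nuP)) _.
apply: etrans _ (esym (congr1 psi (substU c k rhoP))).
apply: etrans (intertwines_iter _ phiI _) _.
apply: etrans (congr1 _ (phi_psi c)) _.
exact: esym (intertwines_iter _ psiI _).
Qed.

Lemma intertwines_id (W : zmodType) (rho : W -> W) : intertwines id rho rho.
Proof. by []. Qed.

Lemma subst_comp n n' (nu : pol n -> pol n) (phi : pol n' -> pol n)
    (rho : pol n' -> pol n') :
  polylinear nu -> polylinear rho -> {morph phi : x y / x + y} ->
  intertwines phi rho nu -> (forall v, phi v%:MP = v%:MP) ->
  forall w, phi (subst rho w) = subst nu w.
Proof.
move=> nuP rhoP phiD phiI phiC.
exact: (subst_transport rhoP nuP phiD (psi := id) _ phiI (intertwines_id nu)).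
Qed.

Lemma eq_subst n (nu nu' : pol n -> pol n) :
  polylinear nu -> polylinear nu' -> nu =1 nu' -> subst nu =1 subst nu'.
Proof.
move=> nuP nuP' E.
exact: (subst_comp nuP' nuP (phi := id) _ E (fun _ => erefl)).
Qed.

(** In one variable the exponent of a monomial is its degree, so that
    multiplying the constant c by lambda as often as the degree says restores
    c lambda^k. *)
Lemma subst_lam_id (w : pol 1) : subst lam w = w.
Proof.
move: w; apply: morphD_ext => // [|c k].
  exact: substD (lam_polylinear V 0).
apply: etrans (substU c k (lam_polylinear V 0)) _.
have lamM := mulmon_monomial V (ucm (ord0 : 'I_1)).
apply: etrans (monomial_mapU (iter_monomial_map (mdeg k) lamM) c mone) _.
congr << c *g _ >>.
apply/eqP/cmP => i; rewrite (ord1 i).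
have ->: forall j (l : 'X_{1..1}),
    iter j (mmul (ucm ord0)) l ord0 = (j + l ord0)%N.
  by move=> j l; elim: j => //= j IH; rewrite cmM IH cmUU.
rewrite cm1 addn0 (@mdegEw _ _ [fset ord0]%fset) ?big_seq_fset1 //.
by apply/fsubsetP => j _; rewrite (ord1 j) in_fset1.
Qed.

End Substitution.

(** * Products with a subscript *)

Section Products.
Variables (R : realType) (V : lmodType {poly R[i]}).
Local Notation pol n := {malg V['X_{1..n}]}.
Variable f : V -> V -> pol 1.
Hypothesis fC : conformal_algebra f.

Lemma conf_addl b : {morph f^~ b : a a' / a + a'}.
Proof.
by move=> a a'; have := conf_linl fC 1 a a' b; rewrite polyC1 scale1r pscale1.
Qed.

Lemma conf_addr a : {morph f a : b b' / b + b'}.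
Proof.
by move=> b b'; have := conf_linr fC 1 a b b'; rewrite polyC1 scale1r pscale1.
Qed.

Section FixedSubscript.
Variables (n : nat) (nu : pol n -> pol n).
Hypothesis nuP : polylinear nu.
Implicit Types x y : pol n.

Let termDl k l b :
  {morph (fun a => mulmon (mmul k l) (subst nu (f a b))) : a a' / a + a'}.
Proof.
exact: comp_morphD (mulmonD (mmul k l))
  (comp_morphD (substD nuP) (conf_addl b)).
Qed.

Let termDr k l a :
  {morph (fun b => mulmon (mmul k l) (subst nu (f a b))) : b b' / b + b'}.
Proof.
exact: comp_morphD (mulmonD (mmul k l))
  (comp_morphD (substD nuP) (conf_addr a)).
Qed.

Lemma pprodDl y : {morph (pprod f nu)^~ y : x x' / x + x'}.
Proof.
apply: (sum_msuppD (F := fun k a => \sum_(l <- msupp y)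
  mulmon (mmul k l) (subst nu (f a y@_l)))) => k.
by apply: sum_morphD => l; apply: termDl.
Qed.

Lemma pprodDr x : {morph pprod f nu x : y y' / y + y'}.
Proof.
apply: (@sum_morphD _ _ _ _ (fun k y => \sum_(l <- msupp y)
  mulmon (mmul k l) (subst nu (f x@_k y@_l)))) => k.
apply: (sum_msuppD (F := fun l b => mulmon (mmul k l) (subst nu (f x@_k b)))).
by move=> l; apply: termDr.
Qed.

Lemma pprodU a k b l : pprod f nu << a *g k >> << b *g l >> =
  mulmon (mmul k l) (subst nu (f a b)).
Proof.
apply: etrans (sum_msuppU (F := fun k a => \sum_(m <- msupp << b *g l >>)
  mulmon (mmul k m) (subst nu (f a << b *g l >>@_m))) a _) _.
  by apply: big1 => m _; apply: (morphD0 (termDl k m _)).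
apply: (sum_msuppU (F := fun l b => mulmon (mmul k l) (subst nu (f a b)))).
exact: (morphD0 (termDr k l a)).
Qed.

Lemma pprodC a b : pprod f nu a%:MP b%:MP = subst nu (f a b).
Proof.
apply: etrans (pprodU a mone b mone) _; rewrite mul1m; exact: mulmon1.
Qed.

Lemma pprod_mulmonl m y :
  intertwines ((pprod f nu)^~ y) (mulmon m) (mulmon m).
Proof.
move=> x; move: x y; have mD := @mulmonD R V n m.
apply: morphD_ext2 => [y|x|y|x|a k b l].
- exact: comp_morphD (pprodDl y) mD.
- exact: pprodDr.
- exact: comp_morphD mD (pprodDl y).
- exact: comp_morphD mD (pprodDr x).
apply: etrans (congr1 ((pprod f nu)^~ _) (mulmonU m a k)) _.
apply: etrans (pprodU a (mmul m k) b l) _.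
apply: etrans _ (esym (congr1 (mulmon m) (pprodU a k b l))).
by apply: etrans _ (esym (mulmonA _ _ _)); rewrite mulmA.
Qed.

Lemma pprod_mulmonr m x : intertwines (pprod f nu x) (mulmon m) (mulmon m).
Proof.
move=> y; move: x y; have mD := @mulmonD R V n m.
apply: morphD_ext2 => [y|x|y|x|a k b l].
- exact: pprodDl.
- exact: comp_morphD (pprodDr x) mD.
- exact: comp_morphD mD (pprodDl y).
- exact: comp_morphD mD (pprodDr x).
apply: etrans (congr1 (pprod f nu _) (mulmonU m b l)) _.
apply: etrans (pprodU a k b (mmul m l)) _.
apply: etrans _ (esym (congr1 (mulmon m) (pprodU a k b l))).
by apply: etrans _ (esym (mulmonA _ _ _)); rewrite !mulmA (mulmC k).
Qed.

(** The axiom (d a) o_lambda b = - lambda (a o_lambda b), extended to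
    polynomials and to an arbitrary subscript. *)
Lemma pprod_derl y : intertwines ((pprod f nu)^~ y) der (\- nu).
Proof.
move=> x; move: x y; have dD := plinD (der_polylinear V n).
have nD := plinD (polylinearN nuP).
apply: morphD_ext2 => [y|x|y|x|a k b l].
- exact: comp_morphD (pprodDl y) dD.
- exact: pprodDr.
- exact: comp_morphD nD (pprodDl y).
- exact: comp_morphD nD (pprodDr x).
apply: etrans (congr1 ((pprod f nu)^~ _) (pscaleU 'X a k)) _.
apply: etrans (pprodU ('X *: a) k b l) _.
apply: etrans _ (esym (congr1 (\- nu) (pprodU a k b l))).
apply: etrans _ (esym (plinM (polylinearN nuP) (mmul k l) _)).
apply: (congr1 (mulmon (mmul k l))).
apply: etrans (congr1 (subst nu) (conf_derl fC a b)) _.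
apply: etrans (morphDN (substD nuP) _) _.
exact: (congr1 -%R (subst_lam nuP (f a b))).
Qed.

(** The axiom a o_lambda (d b) = (d + lambda) (a o_lambda b), extended
    likewise. *)
Lemma pprod_derr x : intertwines (pprod f nu x) der (der \+ nu).
Proof.
move=> y; move: x y; have dD := plinD (der_polylinear V n).
have dnP := polylinearD (der_polylinear V n) nuP; have nD := plinD dnP.
apply: morphD_ext2 => [y|x|y|x|a k b l].
- exact: pprodDl.
- exact: comp_morphD (pprodDr x) dD.
- exact: comp_morphD nD (pprodDl y).
- exact: comp_morphD nD (pprodDr x).
apply: etrans (congr1 (pprod f nu _) (pscaleU 'X b l)) _.
apply: etrans (pprodU a k ('X *: b) l) _.
apply: etrans _ (esym (congr1 (der \+ nu) (pprodU a k b l))).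
apply: etrans _ (esym (plinM dnP (mmul k l) _)).
apply: (congr1 (mulmon (mmul k l))).
apply: etrans (congr1 (subst nu) (conf_derr fC a b)) _.
exact: (intertwinesD (substD nuP) (subst_pscale 'X nuP) (subst_lam nuP)).
Qed.

End FixedSubscript.

End Products.

(** * The opposite product and the commutator *)

Section OppositeProduct.
Variables (R : realType) (V : lmodType {poly R[i]}).
Local Notation pol n := {malg V['X_{1..n}]}.
Implicit Types f g : V -> V -> pol 1.

Definition skew n (nu : pol n -> pol n) : pol n -> pol n := \- (der \+ nu).

Lemma skew_polylinear n (nu : pol n -> pol n) :
  polylinear nu -> polylinear (skew nu).
Proof. by move=> nuP; apply/polylinearN/polylinearD/nuP/der_polylinear. Qed.

Lemma skewK n (nu : pol n -> pol n) : skew (skew nu) =1 nu.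
Proof.
move=> x; rewrite /skew /=; move: (der x) (nu x) => d v.
by rewrite opprD opprK addKr.
Qed.

(** The d inside the inner substitution acts on the coefficients of w, and
    the outer substitution commutes with it; only lambda gets replaced. *)
Lemma subst_skew n (nu : pol n -> pol n) (nuP : polylinear nu) (w : pol 1) :
  subst nu (subst (skew lam) w) = subst (skew nu) w.
Proof.
have SD := substD nuP.
have kP := skew_polylinear (lam_polylinear V 0).
apply: (subst_comp (skew_polylinear nuP) kP SD).
  apply: (intertwinesN SD).
  exact: intertwinesD SD (subst_pscale 'X nuP) (subst_lam nuP).
by move=> v; apply: substC.
Qed.

Definition opposite f : V -> V -> pol 1 := fun a b => subst (skew lam) (f b a).

(** The two sesquilinearity axioms exchange their roles: - d - lambda plays
    the part of lambda, and d + (- d - lambda) = - lambda. *)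
Lemma opposite_conformal f :
  conformal_algebra f -> conformal_algebra (opposite f).
Proof.
move=> fC; have kP := skew_polylinear (lam_polylinear V 0).
have SD := substD kP.
split=> [z a a' b | z a b b' | a b | a b].
- apply: etrans (congr1 (subst (skew lam)) (conf_linr fC z b a a')) _.
  apply: etrans (SD _ _) _.
  exact: (congr1 (+%R^~ _) (subst_pscale _ kP _)).
- apply: etrans (congr1 (subst (skew lam)) (conf_linl fC z b b' a)) _.
  apply: etrans (SD _ _) _.
  exact: (congr1 (+%R^~ _) (subst_pscale _ kP _)).
- apply: etrans (congr1 (subst (skew lam)) (conf_derr fC b a)) _.
  apply: etrans (intertwinesD SD (subst_pscale 'X kP) (subst_lam kP) _) _.
  rewrite /opposite; move: (subst (skew lam) (f b a)) => w.
  rewrite /skew /der /=; move: (pscale 'X w) (lam w) => d v.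
  by rewrite opprD addNKr.
- apply: etrans (congr1 (subst (skew lam)) (conf_derl fC b a)) _.
  apply: etrans (intertwinesN SD (subst_lam kP) _) _.
  exact: opprK.
Qed.

(** This rule turns an exchange of arguments into a change of subscript; it
    is used for the second term of the bracket and for commutativity. *)
Lemma pprod_opposite f (fC : conformal_algebra f) n (nu : pol n -> pol n) x y :
  polylinear nu -> pprod (opposite f) nu x y = pprod f (skew nu) y x.
Proof.
move=> nuP; have oC := opposite_conformal fC; have kP := skew_polylinear nuP.
move: x y; apply: morphD_ext2 => [y|x|y|x|a k b l].
- exact: pprodDl.
- exact: pprodDr.
- exact: pprodDr.
- exact: pprodDl.
apply: etrans (pprodU oC nuP a k b l) _.
apply: etrans _ (esym (pprodU fC kP b l a k)); rewrite (mulmC l).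
exact: (congr1 _ (subst_skew nuP _)).
Qed.

Definition difference f g : V -> V -> pol 1 := fun a b => f a b - g a b.

Lemma difference_conformal f g : conformal_algebra f -> conformal_algebra g ->
  conformal_algebra (difference f g).
Proof.
move=> fC gC; split=> [z a a' b | z a b b' | a b | a b]; rewrite /difference.
- rewrite (conf_linl fC) (conf_linl gC) opprD addrACA.
  exact: (congr1 (+%R^~ _) (esym (morphDB (@pscaleD _ _ _ z%:P) _ _))).
- rewrite (conf_linr fC) (conf_linr gC) opprD addrACA.
  exact: (congr1 (+%R^~ _) (esym (morphDB (@pscaleD _ _ _ z%:P) _ _))).
- rewrite (conf_derl fC) (conf_derl gC) -opprD.
  exact: (congr1 -%R (esym (morphDB (plinD (lam_polylinear V 0)) _ _))).
- rewrite (conf_derr fC) (conf_derr gC).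
  have P := polylinearD (der_polylinear V 1) (lam_polylinear V 0).
  exact: (esym (morphDB (plinD P) _ _)).
Qed.

Lemma pprod_difference f g n (nu : pol n -> pol n) x y :
  conformal_algebra f -> conformal_algebra g -> polylinear nu ->
  pprod (difference f g) nu x y = pprod f nu x y - pprod g nu x y.
Proof.
move=> fC gC nuP; have dC := difference_conformal fC gC.
move: x y; apply: morphD_ext2 => [y|x|y|x|a k b l].
- exact: pprodDl.
- exact: pprodDr.
- move=> x x'; apply: etrans _ (esym (addrACA _ _ _ _)).
  rewrite -opprD; exact: (congr2 (fun u v => u - v)
    (pprodDl fC nuP _ _ _) (pprodDl gC nuP _ _ _)).
- move=> y y'; apply: etrans _ (esym (addrACA _ _ _ _)).
  rewrite -opprD; exact: (congr2 (fun u v => u - v)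
    (pprodDr fC nuP _ _ _) (pprodDr gC nuP _ _ _)).
apply: etrans (pprodU dC nuP a k b l) _.
apply: etrans _ (esym (congr2 (fun u v => u - v) (pprodU fC nuP a k b l)
  (pprodU gC nuP a k b l))).
apply: etrans (congr1 _ (morphDB (substD nuP) _ _)) _.
exact: (morphDB (@mulmonD _ _ _ (mmul k l))).
Qed.

Definition commutator f := difference f (opposite f).

Lemma commutator_conformal f :
  conformal_algebra f -> conformal_algebra (commutator f).
Proof.
by move=> fC; apply: difference_conformal => //; apply: opposite_conformal.
Qed.

Lemma pprod_commutator f n (nu : pol n -> pol n) x y :
  conformal_algebra f -> polylinear nu ->
  pprod (commutator f) nu x y = pprod f nu x y - pprod f (skew nu) y x.
Proof.
move=> fC nuP.
apply: etrans (pprod_difference x y fC (opposite_conformal fC) nuP) _.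
exact: (congr1 (fun u => _ - u) (pprod_opposite fC x y nuP)).
Qed.

Lemma commutator_skew f a b :
  commutator f a b = - subst (\- (lam \+ der)) (commutator f b a).
Proof.
have lP := lam_polylinear V 0; have kP := skew_polylinear lP.
have k'P := polylinearN (polylinearD lP (der_polylinear V 1)).
have E : \- (lam \+ der) =1 skew lam :> (pol 1 -> pol 1).
  by move=> w; apply: (congr1 -%R (addrC (lam w) (der w))).
have -> : subst (\- (lam \+ der)) (commutator f b a) =
    subst (skew lam) (f b a) - f a b.
  apply: etrans (eq_subst k'P kP E _) _.
  apply: etrans (morphDB (substD kP) _ _) _.
  apply: (congr1 (fun u => _ - u)).
  apply: etrans (subst_skew kP _) _.
  apply: etrans (eq_subst (skew_polylinear kP) lP (@skewK _ lam) _) _.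
  exact: subst_lam_id.
by rewrite opprB.
Qed.

End OppositeProduct.

(** * Substitution of two operators in N[lambda, mu] *)

Section TwoVariables.
Variables (R : realType) (V : lmodType {poly R[i]}).
Local Notation pol n := {malg V['X_{1..n}]}.
Variables p q : pol 2 -> pol 2.
Hypotheses (pP : polylinear p) (qP : polylinear q).

Definition subst2 (w : pol 2) : pol 2 :=
  \sum_(m <- msupp w) iter (m ord0) p (iter (m ord_max) q (w@_m)%:MP).

Let termD (m : 'X_{1..2}) :
  {morph (fun c => iter (m ord0) p (iter (m ord_max) q c%:MP)) :
    c c' / c + c'}.
Proof.
exact: (comp_morphD (iter_morphD (m ord0) (plinD pP))
  (iter_constD (m ord_max) qP)).
Qed.

Lemma subst2D : {morph subst2 : w w' / w + w'}.
Proof.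
apply: (sum_msuppD
  (F := fun (m : 'X_{1..2}) c => iter (m ord0) p (iter (m ord_max) q c%:MP))).
exact: termD.
Qed.

Lemma subst2U c m :
  subst2 << c *g m >> = iter (m ord0) p (iter (m ord_max) q c%:MP).
Proof.
apply: (sum_msuppU
  (F := fun (m : 'X_{1..2}) c => iter (m ord0) p (iter (m ord_max) q c%:MP))).
exact: (morphD0 (termD m)).
Qed.

Lemma subst2C c : subst2 c%:MP = c%:MP.
Proof. by apply: etrans (subst2U c mone) _; rewrite !cm1. Qed.

Lemma subst2_lam : intertwines subst2 lam p.
Proof.
apply: morphD_ext => [||c m].
- exact: comp_morphD subst2D (plinD (lam_polylinear V 1)).
- exact: comp_morphD (plinD pP) subst2D.
apply: etrans (congr1 subst2 (mulmonU _ c m)) _.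
apply: etrans (subst2U _ _) _.
apply: etrans _ (esym (congr1 p (subst2U c m))).
by rewrite !cmM cmUU cmU.
Qed.

Hypothesis pq : forall x, p (q x) = q (p x).

(** Unlike lambda, mu has to be moved past the powers of p. *)
Lemma subst2_mu : intertwines subst2 mu q.
Proof.
apply: morphD_ext => [||c m].
- exact: comp_morphD subst2D (plinD (mu_polylinear V)).
- exact: comp_morphD (plinD qP) subst2D.
apply: etrans (congr1 subst2 (mulmonU _ c m)) _.
apply: etrans (subst2U _ _) _.
apply: etrans _ (esym (congr1 q (subst2U c m))).
rewrite !cmM cmUU cmU /=; apply: esym.
by apply: intertwines_iter => x; rewrite pq.
Qed.

End TwoVariables.

(** * Transport of nested products *)

Section NestedProducts.
Variables (R : realType) (V : lmodType {poly R[i]}) (n : nat).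
Local Notation pol n := {malg V['X_{1..n}]}.
Variables (f g : V -> V -> pol 1) (T : pol n -> pol n).
Hypotheses (fC : conformal_algebra f) (gC : conformal_algebra g).
Hypotheses (TD : {morph T : x y / x + y}) (TC : forall c, T c%:MP = c%:MP).
Implicit Types sigma tau rho theta : pol n -> pol n.

(** T changes the outer subscript sigma into sigma'. The inner subscript tau
    acts on the result of the outer product as tau1, hence after T as theta,
    so the new inner subscript rho must act as theta through the product with
    sigma'. *)
Lemma transport_left sigma sigma' tau tau1 rho theta a b c :
  polylinear sigma -> polylinear sigma' -> polylinear tau -> polylinear rho ->
  intertwines T sigma sigma' ->
  intertwines ((pprod f sigma)^~ c%:MP) tau tau1 -> intertwines T tau1 theta ->
  intertwines ((pprod f sigma')^~ c%:MP) rho theta ->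
  T (pprod f sigma (pprod g tau a%:MP b%:MP) c%:MP) =
  pprod f sigma' (pprod g rho a%:MP b%:MP) c%:MP.
Proof.
move=> sP s'P tP rP Ts ft Tt fr.
apply: etrans (congr1 (fun x => T (pprod f sigma x c%:MP))
  (pprodC gC tP a b)) _.
apply: etrans _ (esym (congr1 ((pprod f sigma')^~ c%:MP) (pprodC gC rP a b))).
apply: (subst_transport (phi := fun x => T (pprod f sigma x c%:MP))
  (psi := (pprod f sigma')^~ c%:MP) tP rP _ _ (intertwines_comp ft Tt) fr).
- exact: comp_morphD TD (pprodDl fC sP _).
- exact: pprodDl.
move=> v; apply: etrans (congr1 T (pprodC fC sP v c)) _.
apply: etrans _ (esym (pprodC fC s'P v c)).
exact: subst_comp.
Qed.

Lemma transport_right sigma sigma' tau tau1 rho theta a b c :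
  polylinear sigma -> polylinear sigma' -> polylinear tau -> polylinear rho ->
  intertwines T sigma sigma' ->
  intertwines (pprod f sigma a%:MP) tau tau1 -> intertwines T tau1 theta ->
  intertwines (pprod f sigma' a%:MP) rho theta ->
  T (pprod f sigma a%:MP (pprod g tau b%:MP c%:MP)) =
  pprod f sigma' a%:MP (pprod g rho b%:MP c%:MP).
Proof.
move=> sP s'P tP rP Ts ft Tt fr.
apply: etrans (congr1 (fun x => T (pprod f sigma a%:MP x))
  (pprodC gC tP b c)) _.
apply: etrans _ (esym (congr1 (pprod f sigma' a%:MP) (pprodC gC rP b c))).
apply: (subst_transport (phi := fun x => T (pprod f sigma a%:MP x))
  (psi := pprod f sigma' a%:MP) tP rP _ _ (intertwines_comp ft Tt) fr).
- exact: comp_morphD TD (pprodDr fC sP _).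
- exact: pprodDr.
move=> v; apply: etrans (congr1 T (pprodC fC sP a v)) _.
apply: etrans _ (esym (pprodC fC s'P a v)).
exact: subst_comp.
Qed.

End NestedProducts.

(** * Rotation of the three weights *)

Section Rotation.
Variables (R : realType) (V : lmodType {poly R[i]}).
Local Notation pol n := {malg V['X_{1..n}]}.
Variables (f g : V -> V -> pol 1).
Hypotheses (fC : conformal_algebra f) (gC : conformal_algebra g).

(** As a left factor in a product with subscript lambda + mu, an expression
    has d = - lambda - mu, and so - d - lambda = mu. *)
Lemma pprod_sum_skew a b c :
  pprod f (lam \+ mu) (pprod g (skew lam) a%:MP b%:MP) c%:MP =
  pprod f (lam \+ mu) (pprod g mu a%:MP b%:MP) c%:MP.
Proof.
have lP := lam_polylinear V 1; have mP := mu_polylinear V.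
have sP := polylinearD lP mP; have kP := skew_polylinear lP.
have fD := pprodDl fC sP c%:MP.
have idD : {morph (@id (pol 2)) : u v / u + v} by [].
have idC (v : V) : id v%:MP = v%:MP :> pol 2 by [].
have H := transport_left fC gC idD idC a b sP sP kP mP (intertwines_id _) _
  (intertwines_id _) (pprod_mulmonl fC sP _ _).
apply: H.
apply: eq_intertwines (intertwinesN fD (intertwinesD fD
  (pprod_derl fC sP _) (pprod_mulmonl fC sP _ _))).
have cancel (l m : pol 2) : - (- (l + m) + l) = m.
  by rewrite opprD opprK addrAC subrr add0r.
by move=> x; apply: (cancel (lam x) (mu x)).
Qed.

(** Here {x, y} is meant to be {lambda, mu}, in either order: T gives the
    weight y to the argument b and the weight nu = - d - x - y to the
    argument c, which leaves the weight x to a. The four lemmas below are the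
    four shapes of nested products in the axioms; when the right factor of a
    product has weight w, that product has the subscript - d - w. *)
Variables i j : 'I_2.
Local Notation x := (@mulvar R V 2 i).
Local Notation y := (@mulvar R V 2 j).
Variable nu : pol 2 -> pol 2.
Hypotheses (nuP : polylinear nu) (nuE : nu =1 skew (x \+ y)).
Local Notation T := (subst2 y nu).

Let xP : polylinear x. Proof. exact: mulmon_polylinear. Qed.
Let yP : polylinear y. Proof. exact: mulmon_polylinear. Qed.
Let lP : polylinear lam := lam_polylinear V 1.
Let mP : polylinear mu := mu_polylinear V.
Let sP : polylinear (lam \+ mu) := polylinearD lP mP.
Let kP : polylinear (skew x) := skew_polylinear xP.
Let k'P : polylinear (skew y) := skew_polylinear yP.
Let TD := subst2D yP nuP.
Let TC := subst2C yP nuP.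
Let T_lam : intertwines T lam y := subst2_lam yP nuP.
Let T_mu : intertwines T mu nu.
Proof. by apply: subst2_mu => // z; apply/esym/plinM. Qed.
Let T_sum : intertwines T (lam \+ mu) (skew x).
Proof.
apply: eq_intertwines (intertwinesD TD T_lam T_mu) => z.
apply: etrans (congr1 (+%R (y z)) (nuE z)) _.
rewrite /skew /=; move: (der z) (x z) (y z) => d u v.
by rewrite !addrA opprD addrCA subrr addr0.
Qed.

Lemma rotate_left a b c :
  T (pprod f (lam \+ mu) (pprod g lam b%:MP c%:MP) a%:MP) =
  pprod f (skew x) (pprod g y b%:MP c%:MP) a%:MP.
Proof.
exact: (transport_left fC gC TD TC b c sP kP lP yP T_sum
  (pprod_mulmonl fC sP _ _) T_lam (pprod_mulmonl fC kP _ _)).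
Qed.

Lemma rotate_left_swap a b c :
  T (pprod f (lam \+ mu) (pprod g mu c%:MP b%:MP) a%:MP) =
  pprod f (skew x) (pprod g (skew y) c%:MP b%:MP) a%:MP.
Proof.
have fD := pprodDl fC kP a%:MP.
apply: (transport_left fC gC TD TC c b sP kP mP k'P T_sum
  (pprod_mulmonl fC sP _ _) T_mu).
apply: eq_intertwines (intertwinesN fD (intertwinesD fD
  (pprod_derl fC kP _) (pprod_mulmonl fC kP _ _))).
have sumE (d u v : pol 2) : - (- - (d + u) + v) = - (d + (u + v)).
  by rewrite opprK addrA.
by move=> z; apply: etrans (sumE (der z) (x z) (y z)) (esym (nuE z)).
Qed.

Lemma rotate_right a b c :
  T (pprod f lam b%:MP (pprod g mu c%:MP a%:MP)) =
  pprod f y b%:MP (pprod g (skew x) c%:MP a%:MP).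
Proof.
have fD := pprodDr fC yP b%:MP.
apply: (transport_right fC gC TD TC c a lP yP mP kP T_lam
  (pprod_mulmonr fC lP _ _) T_mu).
apply: eq_intertwines (intertwinesN fD (intertwinesD fD
  (pprod_derr fC yP _) (pprod_mulmonr fC yP _ _))).
have sumE (d u v : pol 2) : - (d + v + u) = - (d + (u + v)).
  by rewrite addrAC addrA.
by move=> z; apply: etrans (sumE (der z) (x z) (y z)) (esym (nuE z)).
Qed.

Lemma rotate_right_swap a b c :
  T (pprod f mu c%:MP (pprod g lam b%:MP a%:MP)) =
  pprod f nu c%:MP (pprod g y b%:MP a%:MP).
Proof.
exact: (transport_right fC gC TD TC b a mP nuP lP yP T_mu
  (pprod_mulmonr fC mP _ _) T_lam (pprod_mulmonr fC nuP _ _)).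
Qed.

End Rotation.

(** * The axioms for rotated arguments *)

Section RotatedIdentities.
Variables (R : realType) (V : lmodType {poly R[i]}).
Local Notation pol n := {malg V['X_{1..n}]}.
Variables (f g : V -> V -> pol 1).
Hypotheses (fC : conformal_algebra f) (gC : conformal_algebra g).
Variables i j : 'I_2.
Local Notation x := (@mulvar R V 2 i).
Local Notation y := (@mulvar R V 2 j).
Variable nu : pol 2 -> pol 2.
Hypotheses (nuP : polylinear nu) (nuE : nu =1 skew (x \+ y)).

Lemma rotate_assoc a b c :
  pprod f (lam \+ mu) (pprod g lam b%:MP c%:MP) a%:MP =
  pprod g lam b%:MP (pprod f mu c%:MP a%:MP) ->
  pprod f (skew x) (pprod g y b%:MP c%:MP) a%:MP =
  pprod g y b%:MP (pprod f (skew x) c%:MP a%:MP).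
Proof.
move=> /(congr1 (subst2 y nu)) H.
apply: etrans (esym (rotate_left fC gC nuP nuE a b c)) _.
exact: etrans H (rotate_right gC fC nuP nuE a b c).
Qed.

(** The hypothesis is left symmetry when f and g coincide, and the second
    Novikov-Poisson axiom when f is the commutative product. *)
Lemma rotate_left_symmetry a b c :
  pprod f (lam \+ mu) (pprod g lam b%:MP c%:MP) a%:MP
  - pprod g lam b%:MP (pprod f mu c%:MP a%:MP) =
  pprod f (lam \+ mu) (pprod g mu c%:MP b%:MP) a%:MP
  - pprod g mu c%:MP (pprod f lam b%:MP a%:MP) ->
  pprod f (skew x) (pprod g y b%:MP c%:MP) a%:MP
  - pprod g y b%:MP (pprod f (skew x) c%:MP a%:MP) =
  pprod f (skew x) (pprod g (skew y) c%:MP b%:MP) a%:MP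
  - pprod g nu c%:MP (pprod f y b%:MP a%:MP).
Proof.
have TD := subst2D (mulmon_polylinear V (ucm j)) nuP.
move=> /(congr1 (subst2 y nu)) H.
apply: etrans (congr2 (fun u v => u - v)
  (esym (rotate_left fC gC nuP nuE a b c))
  (esym (rotate_right gC fC nuP nuE a b c))) _.
apply: etrans (esym (morphDB TD _ _)) _.
apply: etrans H _.
apply: etrans (morphDB TD _ _) _.
exact: (congr2 (fun u v => u - v) (rotate_left_swap fC gC nuP nuE a b c)
  (rotate_right_swap gC fC j nuP a b c)).
Qed.

End RotatedIdentities.

(** * Cancellations *)

Section Cancellations.
Variable W : zmodType.

(** The name x_yz stands for the product of x with (yz), and xy_z for that of
    (xy) with z; the hypotheses are left symmetry for (a,b,c), (b,c,a) and
    (a,c,b), and the conclusion is Jacobi's identity with all brackets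
    expanded. *)
Lemma jacobi_cancellation (a_bc a_cb bc_a cb_a ab_c ba_c c_ab c_ba b_ac b_ca
    ac_b ca_b : W) :
  ab_c - a_bc = ba_c - b_ac -> bc_a - b_ca = cb_a - c_ba ->
  ac_b - a_cb = ca_b - c_ab ->
  (a_bc - a_cb) - (bc_a - cb_a) =
  ((ab_c - c_ab) - (ba_c - c_ba)) + ((b_ac - b_ca) - (ac_b - ca_b)).
Proof.
move=> /eqP; rewrite subr_eq => /eqP ->.
move=> /eqP; rewrite subr_eq => /eqP ->.
move=> /eqP; rewrite subr_eq => /eqP ->.
rewrite !opprD !opprK !addrA [LHS](ACl (1*2*4*5*(3*6))).
rewrite [RHS](ACl (3*11*6*8*(1*5)*(2*7)*(4*10)*(9*12))) /=.
by rewrite !subrr !addNr !addr0.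
Qed.

Lemma transposed_cancellation (a_bc a_cb c_ab b_ac : W) :
  a_bc - b_ac = a_cb - c_ab ->
  (a_bc - a_cb) *+ 2 = (a_bc - c_ab) + (b_ac - a_cb).
Proof.
move=> /eqP; rewrite subr_eq => /eqP ->.
by rewrite mulr2n !addrA [LHS](ACl (1*2*3*6*7*8*(4*5))) /= addNr addr0.
Qed.

End Cancellations.

(** * The commutator of a Novikov-Poisson conformal algebra *)

Section Commutator.
Variables (R : realType) (N : lmodType {poly R[i]}).
Local Notation pol n := {malg N['X_{1..n}]}.
Local Notation l := (@lam R N 1).
Local Notation m := (@mu R N).
Implicit Types circ star : N -> N -> pol 1.

Let lP : polylinear l := lam_polylinear N 1.
Let mP : polylinear m := mu_polylinear N.
Let sP : polylinear (l \+ m) := polylinearD lP mP.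
Let nP : polylinear (skew (l \+ m)) := skew_polylinear sP.

(** In the rotations with x = mu and y = lambda the third weight has its
    variables in the other order. *)
Let skew_sumC : skew (l \+ m) =1 skew (m \+ l).
Proof.
by move=> x; apply: (congr1 (fun u => - (der x + u)) (addrC (l x) (m x))).
Qed.

Lemma commutator_jacobi star a b c : left_symmetric_conformal_algebra star ->
  let br := commutator star in
  pprod br l a%:MP (pprod br m b%:MP c%:MP) =
  pprod br (l \+ m) (pprod br l a%:MP b%:MP) c%:MP
  + pprod br m b%:MP (pprod br l a%:MP c%:MP).
Proof.
move=> [fC lsym] br; have brC : conformal_algebra br := commutator_conformal fC.
have brE (nu : pol 2 -> pol 2) (nuP : polylinear nu) x y :=
  pprod_commutator x y fC nuP.
have inner (nu nu' : pol 2 -> pol 2) (nuP : polylinear nu)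
    (nu'P : polylinear nu') x y z :
  pprod br nu x (pprod br nu' y z) =
    (pprod star nu x (pprod star nu' y z)
     - pprod star nu x (pprod star (skew nu') z y))
    - (pprod star (skew nu) (pprod star nu' y z) x
       - pprod star (skew nu) (pprod star (skew nu') z y) x).
  apply: etrans (congr1 (pprod br nu x) (brE _ nu'P y z)) _.
  apply: etrans (brE _ nuP _ _) _.
  apply: (congr2 (fun u v => u - v)).
    exact: (morphDB (pprodDr fC nuP x)).
  exact: (morphDB (pprodDl fC (skew_polylinear nuP) x)).
apply: etrans (inner l m lP mP _ _ _) _.
(* The flipped half of the inner bracket has subscript - d - lambda, which
   reads mu as soon as the outer product is formed. *)
have brS : pprod br (l \+ m) (pprod br l a%:MP b%:MP) c%:MP =
    (pprod star (l \+ m) (pprod star l a%:MP b%:MP) c%:MP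
     - pprod star (skew (l \+ m)) c%:MP (pprod star l a%:MP b%:MP))
    - (pprod star (l \+ m) (pprod star m b%:MP a%:MP) c%:MP
     - pprod star (skew (l \+ m)) c%:MP (pprod star m b%:MP a%:MP)).
  apply: etrans (congr1 ((pprod br (l \+ m))^~ c%:MP) (brE l lP _ _)) _.
  apply: etrans (morphDB (pprodDl brC sP c%:MP) _ _) _.
  apply: (congr2 (fun u v => u - v)); first exact: brE.
  apply: etrans (pprod_sum_skew brC fC b a c) _.
  exact: brE.
apply: etrans _ (esym (congr2 +%R brS (inner m l mP lP _ _ _))).
apply: jacobi_cancellation.
- exact: lsym.
- exact: (rotate_left_symmetry fC fC (i := ord0) (j := ord_max) nP
    (frefl _) (lsym b c a)).
- exact: (rotate_left_symmetry fC fC (i := ord_max) (j := ord0) nP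
    skew_sumC (lsym a c b)).
Qed.

Lemma commutator_lie star : left_symmetric_conformal_algebra star ->
  lie_conformal_algebra (commutator star).
Proof.
move=> lsP; split.
- exact: commutator_conformal (lsym_conf lsP).
- exact: commutator_skew.
- by move=> a b c; apply: commutator_jacobi.
Qed.

Lemma pprod_comm circ (cP : comm_assoc_conformal_algebra circ) n
    (nu : pol n -> pol n) x y :
  polylinear nu -> pprod circ nu x y = pprod circ (skew nu) y x.
Proof.
move=> nuP; apply: etrans _ (pprod_opposite (cac_conf cP) x y nuP).
apply: eq_bigr => k _; apply: eq_bigr => k' _.
exact: (congr1 (fun w => mulmon (mmul k k') (subst nu w)) (cac_comm cP _ _)).
Qed.

Lemma commutator_compat circ star a b c :
  novikov_poisson_conformal_algebra circ star ->
  let br := commutator star in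
  pprod circ l a%:MP (pprod br m b%:MP c%:MP) *+ 2 =
  pprod br (l \+ m) (pprod circ l a%:MP b%:MP) c%:MP
  + pprod br m b%:MP (pprod circ l a%:MP c%:MP).
Proof.
move=> [cacP [[sC _] _] compat1 compat2] br; have cC := cac_conf cacP.
have brE (nu : pol 2 -> pol 2) (nuP : polylinear nu) x y :=
  pprod_commutator x y sC nuP.
have klP := skew_polylinear lP.
have lhs : pprod circ l a%:MP (pprod br m b%:MP c%:MP) =
    pprod circ l a%:MP (pprod star m b%:MP c%:MP)
    - pprod circ l a%:MP (pprod star (skew m) c%:MP b%:MP).
  apply: etrans (congr1 (pprod circ l a%:MP) (brE m mP _ _)) _.
  exact: (morphDB (pprodDr cC lP a%:MP)).
(* With subscript - d - lambda - mu, the product of c and X is the opposite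
   product of X and c with subscript lambda + mu, in which X is a left
   factor. *)
have flip : pprod star (skew (l \+ m)) c%:MP (pprod circ l a%:MP b%:MP) =
    pprod star (skew (l \+ m)) c%:MP (pprod circ m b%:MP a%:MP).
  apply: etrans (congr1 (pprod star _ c%:MP)
    (pprod_comm cacP a%:MP b%:MP lP)) _.
  apply: etrans (esym (pprod_opposite sC _ _ sP)) _.
  apply: etrans (pprod_sum_skew (opposite_conformal sC) cC b a c) _.
  exact: pprod_opposite.
have E1 : pprod br (l \+ m) (pprod circ l a%:MP b%:MP) c%:MP =
    pprod circ l a%:MP (pprod star m b%:MP c%:MP)
    - pprod star (skew (l \+ m)) c%:MP (pprod circ m b%:MP a%:MP).
  apply: etrans (brE _ sP _ _) _.
  exact: (congr2 (fun u v => u - v) (compat1 a b c) flip).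
have E2 : pprod br m b%:MP (pprod circ l a%:MP c%:MP) =
    pprod star m b%:MP (pprod circ l a%:MP c%:MP)
    - pprod circ l a%:MP (pprod star (skew m) c%:MP b%:MP).
  apply: etrans (brE _ mP _ _) _; apply: (congr1 (fun u => _ - u)).
  exact: (rotate_assoc sC cC (i := ord_max) (j := ord0) nP skew_sumC
    (compat1 a c b)).
apply: etrans (congr1 (fun u => u *+ 2) lhs) _.
apply: etrans _ (esym (congr2 +%R E1 E2)).
apply: transposed_cancellation.
(* Commutativity brings the terms into the form of the second axiom for b, c,
   a, where the argument a stands on the right of the commutative product. *)
apply: etrans (congr2 (fun u v => u - v) (pprod_comm cacP _ _ lP)
  (congr1 (pprod star m b%:MP) (pprod_comm cacP _ _ lP))) _.
apply: etrans _ (esym (congr1 (fun u => u - _) (pprod_comm cacP _ _ lP))).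
exact: (rotate_left_symmetry cC sC (i := ord0) (j := ord_max) nP (frefl _)
  (compat2 b c a)).
Qed.

End Commutator.

Theorem theorem4p4 (R : realType) (N : lmodType {poly R[i]})
    (circ star : N -> N -> {malg N['X_{1..1}]})
    (np : novikov_poisson_conformal_algebra circ star) :
  transposed_poisson_conformal_algebra circ
    (fun a b => star a b - subst (\- (der \+ lam)) (star b a)).
Proof.
split.
- exact: np_circ np.
- exact: commutator_lie (nov_lsym (np_star np)).
- by move=> a b c; apply: commutator_compat.
Qed.
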